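(* Let $d,N\ge1$, $\sigma_0>0$, and let $W^*\in\mathbb{R}^{d\times d}$ be symmetric positive semidefinite. Consider matrices $W_1,\dots,W_N\in\mathbb{R}^{d\times d}$ with product $W=W_NW_{N-1}\cdots W_1$, initialized as $W_n(0)=\sqrt[N]{\sigma_0}\,I$ for all $n$, and trained by gradient flow on the depth-normalized loss $$\ell_N(W_1,\dots,W_N)=\frac{1}{2N}\mathbb{E}_A\big[\langle W_N\cdots W_1-W^*,A\rangle^2\big]=\frac{1}{2N}\|W_N\cdots W_1-W^*\|_F^2,$$ with $A$ having i.i.d. standard Gaussian entries. Then, letting $U$ be an orthogonal matrix diagonalizing $W^*$, $W(t)$ stays diagonalized by $U$ and its singular values satisfy $$\dot\sigma_i(t)=\sigma_i(t)^{2-\frac2N}(\sigma_i^*-\sigma_i(t)),$$ where $\sigma_i$ and $\sigma_i^*$ are the $i$th singular values of $W$ and $W^*$ respectively, corresponding to the same singular vector.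
   Context: $\langle X,Y\rangle=\mathrm{tr}(X^TY)$. Gradient flow means $\dot W_n=-\nabla_{W_n}\ell_N$ for each $n$ in continuous time. *)

(* Defs.v *)
From HB Require Import structures.
From mathcomp Require Import all_boot all_order all_algebra.
From mathcomp Require Import all_classical all_reals all_analysis.
Set Implicit Arguments. Unset Strict Implicit. Unset Printing Implicit Defensive.
Import Order.TTheory GRing.Theory Num.Theory.
Import numFieldNormedType.Exports.
Local Open Scope classical_set_scope.
Local Open Scope ring_scope.

Definition orthogonal_mx (R : realType) (d : nat) (U : 'M[R]_d) : Prop :=
  U^T *m U = 1%:M.

Definition sym_psd (R : realType) (d : nat) (M : 'M[R]_d) : Prop :=
  M^T = M /\ forall v : 'cV[R]_d, 0 <= (v^T *m M *m v) 0 0.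

(* End-to-end product W_N W_{N-1} ... W_1, where W_{k+1} is Ws k (k : 'I_N). *)
Definition prodW (R : realType) (d N : nat) (Ws : 'I_N -> 'M[R]_d) : 'M[R]_d :=
  \big[mulmx/1%:M]_(k < N) Ws (rev_ord k).

Definition frob2 (R : realType) (d : nat) (X : 'M[R]_d) : R :=
  \tr (X^T *m X).

(* Depth-normalized loss l_N = 1/(2N) ||W_N...W_1 - W*||_F^2
   (= 1/(2N) E_A[<W - W*, A>^2] for A with iid standard Gaussian entries). *)
Definition lossN (R : realType) (d N : nat) (Wstar : 'M[R]_d)
    (Ws : 'I_N -> 'M[R]_d) : R :=
  (2 * N%:R)^-1 * frob2 (prodW Ws - Wstar).

Definition perturb (R : realType) (d N : nat) (Ws : 'I_N -> 'M[R]_d)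
    (n : 'I_N) (H : 'M[R]_d) : 'I_N -> 'M[R]_d :=
  fun k => if k == n then Ws k + H else Ws k.

Definition gradN (R : realType) (d N : nat) (Wstar : 'M[R]_d)
    (Ws : 'I_N -> 'M[R]_d) (n : 'I_N) : 'M[R]_d :=
  \matrix_(i, j)
    derive1 (fun s : R => lossN Wstar (perturb Ws n (s *: delta_mx i j))) 0.

Definition gradient_flow (R : realType) (d N : nat) (Wstar : 'M[R]_d)
    (Wt : R -> 'I_N -> 'M[R]_d) : Prop :=
  (forall n i j, (fun s : R => Wt s n i j) @ 0^'+ --> Wt 0 n i j) /\
  (forall t : R, 0 < t -> forall n i j,
      is_derive t 1 (fun s : R => Wt s n i j) (- gradN Wstar (Wt t) n i j)).

(* Main.v *)
(* After conjugation by U the target is diagonal. The matrices V_n = U^T W_n U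
   start in the linear subspace S of families whose members are all equal to
   one diagonal matrix, and the gradient field is polynomial and maps S to S.
   On [0, T] the trajectory is bounded, so the field is Lipschitz there and the
   deviation of V from its projection on S satisfies a Gronwall inequality with
   zero initial value: V never leaves S. On S each diagonal entry v obeys
   v' = - (1/N) v^(N-1) (v^N - s), which keeps v positive, and sigma = v^N
   satisfies the announced equation. *)
Require Import Defs.
From HB Require Import structures.
From mathcomp Require Import all_boot all_order all_algebra.
From mathcomp Require Import all_classical all_reals all_analysis.
From mathcomp Require Import ring lra.
Set Implicit Arguments. Unset Strict Implicit. Unset Printing Implicit Defensive.
Import Order.TTheory GRing.Theory Num.Theory.
Import numFieldNormedType.Exports.
Local Open Scope classical_set_scope.
Local Open Scope ring_scope.

(** * Ordered matrix products and the gradient in closed form *)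

(** Isolates one factor without reordering the others, as matrix products do not commute. *)
Lemma big_ord_split (T : Type) (idx : T) (op : Monoid.law idx) (N : nat)
    (n : 'I_N) (F : 'I_N -> T) :
  \big[op/idx]_(k < N) F k =
  op (op (\big[op/idx]_(k < N | (k < n)%N) F k) (F n))
     (\big[op/idx]_(k < N | (n < k)%N) F k).
Proof.
elim: N n F => [[]//|N IH] n F.
rewrite [X in op (op X _) _]big_mkcond [X in op _ X]big_mkcond !big_ord_recl /=.
have [->|[m ->]] : n = ord0 \/ exists m, n = lift ord0 m.
  by case: (unliftP ord0 n) => [m|] ->; [right; exists m|left].
  by rewrite /= big1_eq !Monoid.mul1m.
by rewrite /= !Monoid.mul1m -!big_mkcond /= (IH m) !Monoid.mulmA.
Qed.

HB.instance Definition _ (R : pzSemiRingType) (d : nat) :=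
  Monoid.isLaw.Build 'M[R]_d 1%:M mulmx
    (@mulmxA R d d d d) (@mul1mx R d d) (@mulmx1 R d d).

(** Because of [rev_ord], this condition on positions selects the factors to the left of [Ws n],
    whose indices exceed [n]; [tailW] collects those to the right. *)
Definition headW (R : realType) (d N : nat) (Ws : 'I_N -> 'M[R]_d) (n : 'I_N) :=
  \big[mulmx/1%:M]_(k < N | (k < rev_ord n)%N) Ws (rev_ord k).

Definition tailW (R : realType) (d N : nat) (Ws : 'I_N -> 'M[R]_d) (n : 'I_N) :=
  \big[mulmx/1%:M]_(k < N | (rev_ord n < k)%N) Ws (rev_ord k).

(** The adjoint of the map sending [H] to [headW Ws n *m H *m tailW Ws n], applied to the residual;
    the 2 from differentiating the square cancels the 2 in [(2 * N%:R)^-1]. *)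
Definition gradF (R : realType) (d N : nat) (Wstar : 'M[R]_d)
    (Ws : 'I_N -> 'M[R]_d) (n : 'I_N) : 'M[R]_d :=
  (N%:R)^-1 *: ((headW Ws n)^T *m (prodW Ws - Wstar) *m (tailW Ws n)^T).

Lemma prodW_split (R : realType) (d N : nat) (Ws : 'I_N -> 'M[R]_d) (n : 'I_N) :
  prodW Ws = headW Ws n *m Ws n *m tailW Ws n.
Proof. by rewrite /prodW (big_ord_split _ (rev_ord n)) rev_ordK. Qed.

Lemma prodW_perturb (R : realType) (d N : nat) (Ws : 'I_N -> 'M[R]_d)
    (n : 'I_N) (H : 'M[R]_d) :
  prodW (perturb Ws n H) =
  prodW Ws + headW Ws n *m H *m tailW Ws n.
Proof.
have perturbE k : k != rev_ord n -> perturb Ws n H (rev_ord k) = Ws (rev_ord k).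
  by rewrite /perturb (can2_eq rev_ordK rev_ordK) => /negbTE ->.
rewrite !(prodW_split _ n) -mulmxDl -mulmxDr {2}/perturb eqxx.
congr (_ *m _ *m _); apply: eq_bigr => k kn; apply: perturbE.
- by rewrite -val_eqE /= neq_ltn kn.
- by rewrite -val_eqE /= neq_ltn kn orbT.
Qed.

Lemma mxtrace_mul_delta (R : comNzRingType) (d : nat) (M : 'M[R]_d) i j :
  \tr (M *m delta_mx i j) = M j i.
Proof.
rewrite /mxtrace (bigD1 j) //= big1 ?addr0 => [|k kj].
  rewrite mxE (bigD1 i) //= big1 ?addr0; first by rewrite mxE !eqxx mulr1.
  by move=> l li; rewrite mxE (negbTE li) mulr0.
by rewrite mxE big1 // => l _; rewrite mxE (negbTE kj) andbF mulr0.
Qed.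

Lemma frob2_line (R : realType) (d : nat) (X Y : 'M[R]_d) (s : R) :
  frob2 (X + s *: Y) = frob2 X + s * (2 * \tr (X^T *m Y)) + s ^+ 2 * frob2 Y.
Proof.
have trYX : \tr (Y^T *m X) = \tr (X^T *m Y).
  by rewrite -mxtrace_tr trmx_mul trmxK.
rewrite /frob2 [(X + _)^T]linearD /= [(_ *: _)^T]linearZ /= mulmxDl !mulmxDr -!scalemxAl -!scalemxAr.
by rewrite !mxtraceD !mxtraceZ trYX; ring.
Qed.

Lemma gradNE (R : realType) (d N : nat) (Wstar : 'M[R]_d)
    (Ws : 'I_N -> 'M[R]_d) (n : 'I_N) :
  gradN Wstar Ws n = gradF Wstar Ws n.
Proof.
apply/matrixP => i j; rewrite mxE derive1E /lossN.
set X := prodW Ws - Wstar.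
set Y := headW Ws n *m delta_mx i j *m tailW Ws n.
pose a := (2 * N%:R)^-1 : R.
(* Along a coordinate line the loss is a quadratic polynomial, whose derivative at 0 is its linear
   coefficient. *)
have -> : (fun s : R => a * frob2 (prodW (perturb Ws n (s *: delta_mx i j)) - Wstar))
  = horner (a *: ((frob2 X)%:P + (2 * \tr (X^T *m Y)) *: 'X + frob2 Y *: 'X^2)).
  apply/funext => s; rewrite hornerZ !hornerD hornerC !hornerZ hornerX hornerXn.
  rewrite prodW_perturb -scalemxAr -scalemxAl addrAC frob2_line -/X -/Y; ring.
have [_ ->] := is_derive_poly (a *: ((frob2 X)%:P + (2 * \tr (X^T *m Y)) *: 'X
  + frob2 Y *: 'X^2)) 0.
rewrite derivZ !derivD derivC !derivZ derivX derivXn /=.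
rewrite hornerZ !hornerD hornerC !hornerZ hornerMn hornerX hornerC.
rewrite mulr1 mul0rn mulr0 add0r addr0.
(* Cyclicity of the trace moves head and tail away from [delta_mx i j], which then reads off a
   single entry. *)
have -> : \tr (X^T *m Y) = ((headW Ws n)^T *m X *m (tailW Ws n)^T) i j.
  rewrite /Y !mulmxA mxtrace_mulC !mulmxA mxtrace_mul_delta.
  transitivity ((tailW Ws n *m X^T *m headW Ws n)^T i j); first by rewrite [RHS]mxE.
  by rewrite !trmx_mul trmxK mulmxA.
by rewrite [RHS]mxE /a invfM mulrACA mulVf ?pnatr_eq0 // mul1r.
Qed.

(** * Orthogonal equivariance and restriction to diagonal families *)

Lemma conj_big (R : realType) (d N : nat) (U : 'M[R]_d) (P : pred 'I_N)
    (F : 'I_N -> 'M[R]_d) :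
  orthogonal_mx U ->
  U^T *m (\big[mulmx/1%:M]_(k < N | P k) F k) *m U =
  \big[mulmx/1%:M]_(k < N | P k) (U^T *m F k *m U).
Proof.
move=> UU; have UUT : U *m U^T = 1%:M by exact: mulmx1C.
apply: (big_morph (fun M => U^T *m M *m U)) => [A B|]; last by rewrite mulmx1.
by rewrite !mulmxA -[_ *m U *m U^T]mulmxA UUT mulmx1.
Qed.

(** Inner factors [U *m U^T] cancel, so a rotated frame sees the same field with a rotated
    target. *)
Lemma gradF_conj (R : realType) (d N : nat) (U Wstar : 'M[R]_d)
    (Ws : 'I_N -> 'M[R]_d) (n : 'I_N) :
  orthogonal_mx U ->
  U^T *m gradF Wstar Ws n *m U =
  gradF (U^T *m Wstar *m U) (fun k => U^T *m Ws k *m U) n.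
Proof.
move=> UU; have UUT : U *m U^T = 1%:M by exact: mulmx1C.
rewrite /gradF /headW /tailW /prodW -!conj_big // -/(headW Ws n) -/(tailW Ws n).
rewrite -/(prodW Ws) -mulmxBl -mulmxBr !trmx_mul !trmxK -scalemxAr -scalemxAl.
by rewrite !mulmxA -!(mulmxA _ U U^T) UUT !mulmx1.
Qed.

Lemma big_mulmx_diag (R : realType) (d N : nat) (P : pred 'I_N) (v : 'rV[R]_d) :
  \big[mulmx/1%:M]_(k < N | P k) diag_mx v =
  diag_mx (\row_i \prod_(k < N | P k) v 0 i).
Proof.
elim: (index_enum _) => [|k r IH].
  by rewrite big_nil; apply/matrixP => i j; rewrite !mxE big_nil.
rewrite big_cons IH; case: ifP => Pk; last first.
  by congr diag_mx; apply/rowP => i; rewrite !mxE big_cons Pk.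
by rewrite mulmx_diag; congr diag_mx; apply/rowP => i; rewrite !mxE big_cons Pk.
Qed.

(** Head and tail together contribute [N.-1] factors, whatever [n] is. Independence of [n] and
    diagonality express that the field is tangent to the invariant subspace. *)
Lemma gradF_diag (R : realType) (d N : nat) (s v : 'rV[R]_d) (n : 'I_N) :
  gradF (diag_mx s) (fun=> diag_mx v) n =
  diag_mx (\row_i ((N%:R)^-1 * (v 0 i ^+ N.-1 * (v 0 i ^+ N - s 0 i)))).
Proof.
have prodE x : \prod_(k < N | (k < rev_ord n)%N) x *
    \prod_(k < N | (rev_ord n < k)%N) x = x ^+ N.-1 :> R.
  transitivity (\prod_(k < N | k != rev_ord n) x); last first.
    by rewrite prodr_const cardC1 card_ord.
  rewrite [RHS](bigID (fun k : 'I_N => (k < rev_ord n)%N)) /=.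
  by congr (_ * _); apply: eq_bigl => k; rewrite -val_eqE /=; case: ltngtP.
rewrite /gradF /headW /tailW /prodW !big_mulmx_diag !tr_diag_mx -linearB /=.
rewrite !mulmx_diag -linearZ /=; congr diag_mx; apply/rowP => i.
by rewrite !mxE mulrAC prodE prodr_const card_ord.
Qed.

(** * Bounded Lipschitz functions *)

(** Both bounds are carried together because a product of Lipschitz functions is Lipschitz only with
    control of their sizes. *)
Definition bdd_lip (R : realType) (X : Type) (B : X -> Prop) (dist : X -> X -> R)
    (g : X -> R) :=
  exists2 C, 0 <= C &
    forall x y, B x -> B y -> `|g x| <= C /\ `|g x - g y| <= C * dist x y.

Lemma bdd_lip_cst (R : realType) (X : Type) (B : X -> Prop) (dist : X -> X -> R)
    (c : R) :
  (forall x y, 0 <= dist x y) -> bdd_lip B dist (fun=> c).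
Proof.
by move=> dist0; exists `|c| => // x y _ _; rewrite subrr normr0 mulr_ge0.
Qed.

Lemma bdd_lipD (R : realType) (X : Type) (B : X -> Prop) (dist : X -> X -> R)
    (f g : X -> R) :
  bdd_lip B dist f -> bdd_lip B dist g -> bdd_lip B dist (fun x => f x + g x).
Proof.
move=> [C C0 fC] [D D0 gD]; exists (C + D) => [|x y Bx By].
  by rewrite addr_ge0.
have [f1 f2] := fC x y Bx By; have [g1 g2] := gD x y Bx By; split.
  by rewrite (le_trans (ler_normD _ _)) // lerD.
by rewrite opprD addrACA mulrDl (le_trans (ler_normD _ _)) // lerD.
Qed.

Lemma bdd_lipM (R : realType) (X : Type) (B : X -> Prop) (dist : X -> X -> R)
    (f g : X -> R) :
  bdd_lip B dist f -> bdd_lip B dist g -> bdd_lip B dist (fun x => f x * g x).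
Proof.
move=> [C C0 fC] [D D0 gD]; exists (C * D + C * D) => [|x y Bx By].
  by rewrite addr_ge0 // mulr_ge0.
have [f1 f2] := fC x y Bx By; have [g1 g2] := gD x y Bx By.
have [gy _] := gD y x By Bx; split.
  by rewrite normrM (le_trans (ler_pM _ _ f1 g1)) // lerDl mulr_ge0.
have -> : f x * g x - f y * g y = f x * (g x - g y) + (f x - f y) * g y by ring.
rewrite (le_trans (ler_normD _ _)) // [leRHS]mulrDl !normrM lerD //.
  by rewrite -mulrA ler_pM.
by rewrite mulrAC ler_pM.
Qed.

Lemma bdd_lip_sum (R : realType) (X : Type) (B : X -> Prop) (dist : X -> X -> R)
    (I : Type) (r : seq I) (f : I -> X -> R) :
  (forall x y, 0 <= dist x y) ->
  (forall i, bdd_lip B dist (f i)) -> bdd_lip B dist (fun x => \sum_(i <- r) f i x).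
Proof.
move=> dist0 fB; elim: r => [|i r IH].
  under eq_fun do rewrite big_nil; exact: bdd_lip_cst.
by under eq_fun do rewrite big_cons; exact: bdd_lipD.
Qed.

Lemma bdd_lip_mulmx (R : realType) (X : Type) (B : X -> Prop) (dist : X -> X -> R)
    (m n p : nat) (F : X -> 'M[R]_(m, n)) (G : X -> 'M[R]_(n, p)) :
  (forall x y, 0 <= dist x y) ->
  (forall i j, bdd_lip B dist (fun x => F x i j)) ->
  (forall i j, bdd_lip B dist (fun x => G x i j)) ->
  forall i j, bdd_lip B dist (fun x => (F x *m G x) i j).
Proof.
move=> dist0 FB GB i j; under eq_fun do rewrite mxE.
by apply: bdd_lip_sum => // k; exact: bdd_lipM.
Qed.

Lemma bdd_lip_big_mulmx (R : realType) (X : Type) (B : X -> Prop)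
    (dist : X -> X -> R) (d N : nat) (P : pred 'I_N) (F : 'I_N -> X -> 'M[R]_d) :
  (forall x y, 0 <= dist x y) ->
  (forall k i j, bdd_lip B dist (fun x => F k x i j)) ->
  forall i j,
    bdd_lip B dist (fun x => (\big[mulmx/1%:M]_(k < N | P k) F k x) i j).
Proof.
move=> dist0 FB; elim: (index_enum _) => [|k r IH] i j.
  by under eq_fun do rewrite big_nil; exact: bdd_lip_cst.
under eq_fun do rewrite big_cons; case: (P k) => //.
exact: (@bdd_lip_mulmx _ _ _ _ _ _ _ (F k)).
Qed.

(** Each entry of the field is a polynomial in the entries of the factors. *)
Lemma bdd_lip_gradF (R : realType) (d N : nat) (B : ('I_N -> 'M[R]_d) -> Prop)
    (dist : ('I_N -> 'M[R]_d) -> ('I_N -> 'M[R]_d) -> R) (Wstar : 'M[R]_d) :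
  (forall x y, 0 <= dist x y) ->
  (forall n i j, bdd_lip B dist (fun Ws => Ws n i j)) ->
  forall n i j, bdd_lip B dist (fun Ws => gradF Wstar Ws n i j).
Proof.
move=> dist0 BW n i j.
have prod_lip P k l : bdd_lip B dist (fun Ws : 'I_N -> 'M[R]_d =>
    (\big[mulmx/1%:M]_(m < N | P m) Ws (rev_ord m)) k l).
  exact: (@bdd_lip_big_mulmx _ _ _ _ _ _ _ (fun m Ws => Ws (rev_ord m))).
under eq_fun do rewrite mxE; apply: bdd_lipM; first exact: bdd_lip_cst.
apply: (@bdd_lip_mulmx _ _ _ _ _ _ _
  (fun Ws : 'I_N -> 'M[R]_d => (headW Ws n)^T *m (prodW Ws - Wstar))) => // k l.
  apply: (@bdd_lip_mulmx _ _ _ _ _ _ _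
    (fun Ws : 'I_N -> 'M[R]_d => (headW Ws n)^T)) => // {}k {}l.
    by under eq_fun do rewrite mxE; exact: prod_lip.
  under eq_fun do rewrite mxE [X in _ + X]mxE.
  by apply: bdd_lipD; [exact: prod_lip|exact: bdd_lip_cst].
by under eq_fun do rewrite mxE; exact: prod_lip.
Qed.

(** * Calculus along trajectories *)

(* The regularity that [gradient_flow] grants along a trajectory. *)
Definition evolves (R : realType) (f f' : R -> R) :=
  (f @ 0^'+ --> f 0) /\ (forall t : R, 0 < t -> is_derive t 1 f (f' t)).

(** Derivatives are compared at positive times only, since identities along the flow are known only
    there. *)
Lemma evolves_ext (R : realType) (f g f' g' : R -> R) :
  f =1 g -> (forall t, 0 < t -> f' t = g' t) -> evolves f f' -> evolves g g'.
Proof.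
move=> /funext -> f'g' [g0 dg]; split=> // t t0.
by rewrite -f'g' //; exact: dg.
Qed.

Lemma evolves_cst (R : realType) (c : R) : evolves (fun=> c) (fun=> 0).
Proof. by split=> [|t _]; [exact: cvg_cst|exact: is_derive_cst]. Qed.

Lemma evolvesD (R : realType) (f g f' g' : R -> R) :
  evolves f f' -> evolves g g' ->
  evolves (fun t => f t + g t) (fun t => f' t + g' t).
Proof.
move=> [f0 df] [g0 dg]; split=> [|t t0]; first exact: cvgD.
by apply: is_deriveD; [exact: df|exact: dg].
Qed.

Lemma evolvesM (R : realType) (f g f' g' : R -> R) :
  evolves f f' -> evolves g g' ->
  evolves (fun t => f t * g t) (fun t => f t * g' t + f' t * g t).
Proof.
move=> [f0 df] [g0 dg]; split=> [|t t0]; first exact: cvgM.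
rewrite [f' t * _]mulrC.
by apply: is_deriveM; [exact: df|exact: dg].
Qed.

Lemma evolvesZ (R : realType) (c : R) (f f' : R -> R) :
  evolves f f' -> evolves (fun t => c * f t) (fun t => c * f' t).
Proof.
move=> df; apply: evolves_ext (evolvesM (evolves_cst c) df) => // t _.
by rewrite mul0r addr0.
Qed.

Lemma evolves_sum (R : realType) (I : Type) (r : seq I) (f f' : I -> R -> R) :
  (forall i, evolves (f i) (f' i)) ->
  evolves (fun t => \sum_(i <- r) f i t) (fun t => \sum_(i <- r) f' i t).
Proof.
move=> df; elim: r => [|i r IH].
  by apply: evolves_ext (evolves_cst 0) => t *; rewrite big_nil.
by apply: evolves_ext (evolvesD (df i) IH) => t *; rewrite big_cons.
Qed.

Lemma evolvesX (R : realType) (n : nat) (f f' : R -> R) :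
  evolves f f' -> evolves (fun t => f t ^+ n) (fun t => n%:R * f t ^+ n.-1 * f' t).
Proof.
move=> df; elim: n => [|n IH].
  by apply: evolves_ext (evolves_cst 1) => t *; rewrite ?mul0r ?mulr0n ?mul0r // expr0.
apply: evolves_ext (evolvesM df IH) => t *; first by rewrite exprS.
case: n {IH} => [|n] /=; first by rewrite !expr0 !mul0r mulr0 !mul1r mulr1 add0r.
by rewrite -[in RHS]natr1 !exprS; ring.
Qed.

Lemma evolves_expR (R : realType) (c : R) :
  evolves (fun t => expR (c * t)) (fun t => c * expR (c * t)).
Proof.
have dexp (t : R) : is_derive t 1 (fun t : R => expR (c * t)) (c * expR (c * t)).
  have dc : is_derive t 1 (fun t : R => c * t) c.
    by apply: is_derive_eq (is_deriveZ c (is_derive_id t 1)) _; exact: mulr1.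
  apply: is_derive_eq (is_derive1_comp (is_derive_expR (c * t)) dc) _.
  by rewrite mulrC.
split=> [|t _]; last exact: dexp.
apply: cvg_at_right_filter.
by case: (dexp 0) => /derivable1_diffP/differentiable_continuous.
Qed.

Lemma evolves_continuous (R : realType) (f f' : R -> R) (T : R) :
  evolves f f' -> 0 < T -> {within `[0, T], continuous f}.
Proof.
move=> [f0 df] T0.
have cf t : 0 < t -> {for t, continuous f}.
  by move=> /df[+ _] => /derivable1_diffP/differentiable_continuous.
apply/continuous_within_itvP => //; split=> //.
- by move=> t /[!in_itv]/= /andP[t0 _]; exact: cf.
- exact/cvg_at_left_filter/cf.
Qed.

Lemma evolves_bounded (R : realType) (f f' : R -> R) (T : R) :
  evolves f f' -> 0 < T -> exists M, forall t, 0 <= t <= T -> `|f t| <= M.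
Proof.
move=> df T0; have T0' := ltW T0.
have [a _ fa] := EVT_max T0' (evolves_continuous df T0).
have dNf := evolvesZ (-1) df.
have [b _ fb] := EVT_max T0' (evolves_continuous dNf T0).
exists (Num.max (f a) (-1 * f b)) => t tT.
rewrite ler_norml lerNl !le_max.
move: (fa t) (fb t); rewrite in_itv /= tT !mulN1r => /(_ isT) -> /(_ isT) ->.
by rewrite orbT.
Qed.

Lemma evolves_bounded_family (R : realType) (I : finType) (f f' : I -> R -> R)
    (T : R) :
  (forall i, evolves (f i) (f' i)) -> 0 < T ->
  exists M, forall i t, 0 <= t <= T -> `|f i t| <= M.
Proof.
move=> df T0.
have [M fM] := choice (fun i => evolves_bounded (df i) T0).
exists (\sum_i `|M i|) => i t tT.
rewrite (le_trans (fM i t tT)) // (bigD1 i) //= (le_trans (ler_norm _)) //.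
by rewrite lerDl sumr_ge0.
Qed.

(** * Gronwall estimates *)

(** The integrating factor [expR (- K * t)] makes the product nonincreasing on [[0, T]]. Applied to
    a negated function, this yields lower bounds. *)
Lemma gronwall (R : realType) (f f' : R -> R) (K T : R) :
  evolves f f' -> 0 < T -> (forall t, 0 < t < T -> f' t <= K * f t) ->
  f T <= f 0 * expR (K * T).
Proof.
move=> df T0 f'K.
have dg := evolvesM df (evolves_expR (- K)).
have [_ dgt] := dg.
have cg := evolves_continuous dg T0.
have -> : f 0 = f 0 * expR (- K * 0) by rewrite mulr0 expR0 mulr1.
suff : f T * expR (- K * T) <= f 0 * expR (- K * 0).
  move/(ler_wpM2r (expR_ge0 (K * T))).
  by rewrite -[leLHS]mulrA -expRD mulNr addNr expR0 mulr1.
apply: (ler0_derive1_le_cc _ _ cg); rewrite ?in_itv /= ?lexx ?ltW //.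
  by move=> t /[!in_itv]/= /andP[t0 _]; case: (dgt t t0).
move=> t /[!in_itv]/= /andP[t0 tT]; rewrite derive1E.
have [_ ->] := dgt t t0.
rewrite mulrA -mulrDl pmulr_lle0 ?expR_gt0 // mulrN addrC subr_le0 mulrC.
by rewrite f'K // t0.
Qed.

Lemma evolves_mulmx (R : realType) (m n p q : nat) (A : 'M[R]_(m, n))
    (B : 'M[R]_(p, q)) (F F' : R -> 'M[R]_(n, p)) :
  (forall k l, evolves (fun t => F t k l) (fun t => F' t k l)) ->
  forall i j, evolves (fun t => (A *m F t *m B) i j)
                      (fun t => (A *m F' t *m B) i j).
Proof.
move=> dF i j.
have entryE (M : 'M[R]_(n, p)) :
    (A *m M *m B) i j = \sum_l \sum_k (A i k * B l j) * M k l.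
  rewrite mxE; apply: eq_bigr => l _; rewrite mxE big_distrl /=.
  by apply: eq_bigr => k _; rewrite mulrAC.
under eq_fun do rewrite entryE; under [X in evolves _ X]eq_fun do rewrite entryE.
apply: evolves_sum => l; apply: evolves_sum => k; exact: evolvesZ.
Qed.

(** The sum of squares [E] is differentiable, unlike the sum of absolute values; it satisfies
    [E' <= 2 * C * #|I| * E] and starts at 0. *)
Lemma gronwall_family (R : realType) (I : finType) (z z' : I -> R -> R)
    (C T : R) :
  (forall i, evolves (z i) (z' i)) -> (forall i, z i 0 = 0) ->
  0 < T -> 0 <= C ->
  (forall t i, 0 < t < T -> `|z' i t| <= C * \sum_j `|z j t|) ->
  forall i, z i T = 0.
Proof.
move=> dz z0 T0 C0 z'C i.
pose E t := \sum_j z j t ^+ 2.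
have dE : evolves E (fun t => \sum_j 2 * z j t ^+ 1 * z' j t).
  by apply: evolves_sum => j; exact: (evolvesX 2).
suff /eqP : E T = 0.
  rewrite psumr_eq0 => [/allP/(_ i (mem_index_enum _))|j _]; last exact: sqr_ge0.
  by rewrite /= sqrf_eq0 => /eqP.
apply/le_anti/andP; split; last by apply: sumr_ge0 => j _; exact: sqr_ge0.
have E0 : E 0 = 0 by rewrite /E big1 // => j _; rewrite z0 expr0n.
suff /(gronwall dE T0) : forall t, 0 < t < T ->
    \sum_j 2 * z j t ^+ 1 * z' j t <= (2 * C * #|I|%:R) * E t.
  by rewrite E0 mul0r.
move=> t tT.
(* As a double sum, the bound follows termwise from [2 |a| |b| <= a ^ 2 + b ^ 2]. *)
have -> : 2 * C * #|I|%:R * E t =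
    \sum_j (C * (#|I|%:R * z j t ^+ 2 + E t)).
  by rewrite -mulr_sumr big_split /= -mulr_sumr sumr_const -/(E t) -mulr_natl; ring.
apply: ler_sum => j _.
have -> : #|I|%:R * z j t ^+ 2 + E t = \sum_k (z j t ^+ 2 + z k t ^+ 2).
  by rewrite big_split /= sumr_const -[X in _ = X + _]mulr_natl.
rewrite expr1 (le_trans (ler_norm _)) // !normrM ger0_norm //.
rewrite (le_trans (ler_wpM2l _ (z'C t j tT))) ?mulr_ge0 //.
rewrite mulrCA ler_wpM2l // mulr_sumr; apply: ler_sum => k _.
rewrite -(real_normK (num_real (z j t))) -(real_normK (num_real (z k t))).
have := sqr_ge0 (`|z j t| - `|z k t|); rewrite sqrrB; lra.
Qed.

(** * Positivity and invariance of the diagonal form *)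

Lemma evolves_pos (R : realType) (m : nat) (s : R) (v : R -> R) :
  evolves v (fun t => - (m.+1%:R^-1 * (v t ^+ m * (v t ^+ m.+1 - s)))) ->
  0 < v 0 -> 0 <= s -> forall t, 0 <= t -> 0 < v t.
Proof.
move=> dv v0 s0 T; rewrite le_eqVlt => /predU1P[<-//|].
case: m dv => [|m] dv T0.
  (* Depth one: [s >= 0] gives [v' >= - v], so Gronwall for [- v] bounds [v] below by a positive
     exponential. *)
  have := gronwall (K := -1) (evolvesZ (-1) dv) T0.
  rewrite !mulN1r lerNl mulNr opprK => vT.
  apply: lt_le_trans (vT _); first by rewrite mulr_gt0 ?expR_gt0.
  move=> t _; rewrite !mulN1r !opprK invr1 expr0 !mul1r expr1.
  by rewrite lerBlDr lerDl.
(* For N >= 2 the equation is v' = c v with c locally bounded, so v ^ 2 decays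
   at most exponentially and v cannot vanish. *)
pose c t := - (m.+2%:R^-1 * (v t ^+ m * (v t ^+ m.+2 - s))).
have v_neq0 t : 0 < t -> v t != 0.
  move=> t0.
  (* [c] is polynomial in [v], hence continuous and bounded on [[0, t]]. *)
  have [c' dc] : exists c', evolves c c'.
    eexists; apply: evolves_ext (evolvesZ (- m.+2%:R^-1) (evolvesM (evolvesX m dv)
      (evolvesD (evolvesX m.+2 dv) (evolves_cst (- s))))) => // u.
    by rewrite /c mulNr.
  have [M cM] := evolves_bounded dc t0.
  have := gronwall (K := - 2 * M) (evolvesZ (-1) (evolvesX 2 dv)) t0.
  rewrite !mulN1r lerNl -mulNr opprK => vt.
  rewrite -sqrf_eq0 gt_eqF //; apply: lt_le_trans (vt _).
    by rewrite mulr_gt0 ?expR_gt0 ?exprn_gt0.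
  move=> u /andP[u0 ut].
  have /cM : 0 <= u <= t by rewrite !ltW.
  rewrite ler_norml => /andP[cMu _].
  have -> : -1 * (2 * v u ^+ 2.-1 *
     - (m.+2%:R^-1 * (v u ^+ m.+1 * (v u ^+ m.+2 - s)))) = - 2 * c u * v u ^+ 2.
    by rewrite /c /= expr1 (exprS _ m); ring.
  have := mulr_ge0 (sqr_ge0 (v u)) (_ : 0 <= M + c u).
  by rewrite -lerBlDl sub0r => /(_ cMu); nra.
(* A negative [v T] would force a zero in [[0, T]], excluded at time 0 by hypothesis and later by
   [v_neq0]. *)
rewrite lt_neqAle eq_sym v_neq0 //= leNgt; apply/negP => vT.
have [|u] := IVT (ltW T0) (evolves_continuous dv T0) (v := 0).
  by rewrite ge_min le_max (ltW vT) (ltW v0) orbT.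
rewrite in_itv /= => /andP[]; rewrite le_eqVlt => /predU1P[<- _ vu|u0 _ /eqP].
  by rewrite vu ltxx in v0.
by rewrite (negbTE (v_neq0 u u0)).
Qed.

(** No solution inside the subspace has to be constructed: at each time the trajectory is compared
    with its own projection. *)
Lemma flow_stays_diag (R : realType) (d N : nat) (s : 'rV[R]_d) (c : R)
    (V : R -> 'I_N -> 'M[R]_d) (n0 : 'I_N) :
  (forall n i j, evolves (fun t => V t n i j)
                         (fun t => - gradF (diag_mx s) (V t) n i j)) ->
  (forall n, V 0 n = c%:M) ->
  forall t, 0 <= t -> V t = fun=> diag_mx (\row_i V t n0 i i).
Proof.
move=> dV V0 T; rewrite le_eqVlt => /predU1P[<-|T0].
  apply/funext => n; rewrite V0; apply/matrixP => i j.
  by rewrite !mxE V0 mxE eqxx.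
pose q := ('I_N * 'I_d * 'I_d)%type.
(* This projection copies the diagonal of the reference factor [n0] into every factor. *)
pose proj (W : 'I_N -> 'M[R]_d) (n : 'I_N) := diag_mx (\row_i W n0 i i).
pose dist (x y : 'I_N -> 'M[R]_d) :=
  \sum_(p : q) `|x p.1.1 p.1.2 p.2 - y p.1.1 p.1.2 p.2|.
(* The part of the field transverse to the subspace. It vanishes on projected families, so its size
   at [V t] is at most a constant times the distance to the projection. *)
pose h (p : q) (W : 'I_N -> 'M[R]_d) := gradF (diag_mx s) W p.1.1 p.1.2 p.2 -
  (p.1.2 == p.2)%:R * gradF (diag_mx s) W n0 p.1.2 p.1.2.
pose z (p : q) t := V t p.1.1 p.1.2 p.2 - (p.1.2 == p.2)%:R * V t n0 p.1.2 p.1.2.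
have projE W (p : q) :
    proj W p.1.1 p.1.2 p.2 = (p.1.2 == p.2)%:R * W n0 p.1.2 p.1.2.
  by rewrite !mxE mulr_natl.
have dist0 x y : 0 <= dist x y by exact: sumr_ge0.
have hproj p W : h p (proj W) = 0.
  by rewrite /h /proj !gradF_diag !mxE eqxx mulr1n mulr_natl subrr.
have dz p : evolves (z p) (fun t => - h p (V t)).
  have := evolvesD (dV p.1.1 p.1.2 p.2)
    (evolvesZ (- (p.1.2 == p.2)%:R) (dV n0 p.1.2 p.1.2)).
  by apply: evolves_ext => t *; rewrite /z /h; ring.
have z0 p : z p 0 = 0.
  by rewrite /z !V0 !mxE eqxx mulr1n mulr_natl subrr.
have [M VM] := evolves_bounded_family (fun p : q => dV p.1.1 p.1.2 p.2) T0.
pose B (W : 'I_N -> 'M[R]_d) := forall n i j, `|W n i j| <= M.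
have BV t : 0 <= t <= T -> B (V t).
  by move=> tT n i j; exact: VM (n, i, j) t tT.
(* Entries of the projection are 0 or entries of [W], so the Lipschitz bound may be used at both
   points. *)
have Bproj W : B W -> B (proj W).
  move=> BW n i j; rewrite !mxE; case: eqP => _; rewrite ?mulr1n //.
  by rewrite mulr0n normr0 (le_trans _ (BW n i j)).
have entry_lip n i j : bdd_lip B dist (fun W => W n i j).
  (* The 1 serves as Lipschitz constant and the absolute value of [M] as bound. *)
  exists (1 + `|M|) => [|x y Bx By]; first by rewrite addr_ge0.
  split.
    by rewrite (le_trans (Bx n i j)) // (le_trans (ler_norm M)) // lerDr.
  rewrite -[leLHS]mul1r ler_pM ?lerDl //.
  by rewrite /dist (bigD1 (n, i, j)) //= lerDl sumr_ge0.
have hlip p : bdd_lip B dist (h p).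
  apply: bdd_lipD; first exact: bdd_lip_gradF.
  under eq_fun do rewrite -mulNr; apply: bdd_lipM; first exact: bdd_lip_cst.
  exact: bdd_lip_gradF.
have [C hC] := choice (fun p => let: ex_intro2 C C0 H := hlip p in
  ex_intro (fun C => 0 <= C /\ _) C (conj C0 H)).
have zT : forall p, z p T = 0.
  apply: (gronwall_family (C := \sum_p C p) dz z0 T0).
    by apply: sumr_ge0 => p _; case: (hC p).
  move=> t p /andP[/ltW t0 /ltW tT].
  have BVt : B (V t) by apply: BV; rewrite t0.
  have [_ /(_ _ _ BVt (Bproj _ BVt))[_]] := hC p.
  rewrite hproj subr0 normrN => /le_trans; apply.
  rewrite ler_pM //; first by case: (hC p).
    by rewrite (bigD1 p) //= lerDl; apply: sumr_ge0 => i _; case: (hC i).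
  by apply: ler_sum => r _; rewrite projE.
apply/funext => n; apply/matrixP => i j.
have /eqP := zT (n, i, j); rewrite subr_eq0 => /eqP /= ->.
by rewrite !mxE mulr_natl.
Qed.

(** As [U] is orthogonal and the entries of [sigma t] are positive, these are the singular values of
    the product, each paired with its column of [U]. *)
Theorem theorem4 (R : realType) (d N : nat) (sigma0 : R) (Wstar : 'M[R]_d)
    (Wt : R -> 'I_N -> 'M[R]_d) (U : 'M[R]_d) (sstar : 'rV[R]_d) :
  (0 < d)%N -> (0 < N)%N -> 0 < sigma0 ->
  sym_psd Wstar ->
  (forall n, Wt 0 n = (sigma0 `^ (N%:R)^-1)%:M) ->
  gradient_flow Wstar Wt ->
  orthogonal_mx U ->
  U^T *m Wstar *m U = diag_mx sstar ->
  exists sigma : R -> 'rV[R]_d,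
    (forall t : R, 0 <= t ->
       U^T *m prodW (Wt t) *m U = diag_mx (sigma t) /\
       (forall i, 0 < sigma t 0 i)) /\
    (forall t : R, 0 < t -> forall i,
       is_derive t 1 (fun s : R => sigma s 0 i)
         (sigma t 0 i `^ (2 - 2 / N%:R) * (sstar 0 i - sigma t 0 i))).
Proof.
move=> _; case: N Wt => // m Wt _ sigma0_gt0 [_ psd] W0 [cW dW] UU UWU.
pose V t (n : 'I_m.+1) := U^T *m Wt t n *m U.
pose c := sigma0 `^ (m.+1%:R)^-1.
have dV n i j : evolves (fun t => V t n i j)
    (fun t => - gradF (diag_mx sstar) (V t) n i j).
  have : forall k l, evolves (fun t => Wt t n k l)
      (fun t => (- gradF Wstar (Wt t) n) k l).
    move=> k l; split=> [|t t0]; first exact: cW.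
    by rewrite mxE -gradNE; exact: dW.
  move=> /(@evolves_mulmx _ _ _ _ _ U^T U) /(_ i j); apply: evolves_ext => // t _.
  by rewrite mulmxN mulNmx mxE gradF_conj // UWU.
have V0 n : V 0 n = c%:M.
  by rewrite /V W0 scalar_mxC -mulmxA UU mulmx1.
pose v t i := V t ord0 i i.
have Vdiag t : 0 <= t -> V t = fun=> diag_mx (\row_i v t i).
  exact: flow_stays_diag dV V0 t.
have sstar_ge0 i : 0 <= sstar 0 i.
  (* The quadratic form of [Wstar] at column [i] of [U] equals [sstar 0 i]. *)
  have := psd (U *m delta_mx i 0).
  rewrite trmx_mul !mulmxA -[_ *m _ *m Wstar]mulmxA -[_ *m _ *m U]mulmxA.
  by rewrite UWU trmx_delta -rowE -colE !mxE eqxx.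
have dv i : evolves (v^~ i)
    (fun t => - (m.+1%:R^-1 * (v t i ^+ m * (v t i ^+ m.+1 - sstar 0 i)))).
  apply: evolves_ext (dV ord0 i i) => // t t0.
  by rewrite (Vdiag t (ltW t0)) gradF_diag !mxE eqxx mulr1n.
have v_gt0 t i : 0 <= t -> 0 < v t i.
  move=> t0; apply: (evolves_pos (dv i)) => //.
  by rewrite /v V0 mxE eqxx mulr1n powR_gt0.
exists (fun t => \row_i (v t i ^+ m.+1)); split=> [t t0|t t0 i].
  split=> [|i]; last by rewrite mxE exprn_gt0 // v_gt0.
  rewrite /prodW conj_big //.
  under eq_bigr => k _ do rewrite -/(V t (rev_ord k)) Vdiag //.
  rewrite big_mulmx_diag; congr diag_mx; apply/rowP => i.
  by rewrite !mxE prodr_const card_ord.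
(* The chain rule for [v ^+ N] brings a factor [N * v ^+ m], with [N = m.+1]; it cancels the [1 / N]
   of the flow and leaves [v ^+ (2 * m)] before the difference. *)
have [_ /(_ t t0)] := evolvesX m.+1 (dv i).
under [X in _ -> is_derive _ _ X _]eq_fun do rewrite mxE.
move=> /is_derive_eq; apply; rewrite mxE /=.
have v0 := v_gt0 t i (ltW t0).
(* The exponents agree because [N * (2 - 2 / N) = 2 * m]; positivity of [v] turns natural powers
   into real ones. *)
have -> : (v t i ^+ m.+1) `^ (2 - 2 / m.+1%:R) = v t i ^+ m * v t i ^+ m.
  rewrite -exprD -!powR_mulrn ?ltW // -powRrM; congr (_ `^ _).
  by rewrite natrD -natr1; field; rewrite natr1 pnatr_eq0.
have m0 : m.+1%:R != 0 :> R by rewrite pnatr_eq0.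
by field.
Qed.
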